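(* Let $S$ be a finite nonempty set, $W$ an infinite countable set, $\Gamma=S^W$ with its Borel $\sigma$-algebra $\mathcal B$, and let $P(x,\cdot)$ be a transition probability kernel on $(\Gamma,\mathcal B)$ satisfying conditions (A1)–(A4) (listed in the context). Let $\widehat{\mathcal B}$ be the spatial tail $\sigma$-algebra. Then for any $A\in\widehat{\mathcal B}$ the function $x\mapsto P(x,A)$ is $\widehat{\mathcal B}$-measurable. Moreover, for any Borel probability measure $\nu$ on $\Gamma$ such that $I(\nu)<\infty$, one has $$\int_\Gamma P(x,A)\,\nu(dx)=\nu(A)\qquad\text{for every }A\in\widehat{\mathcal B}.$$
   Context: $\Gamma=S^W$ carries the product of the discrete topologies (it is compact metrizable); $M(\Gamma)$ is the set of Borel probability measures on $\Gamma$. For $\Phi\subset\Psi\subset W$, $\pi_\Phi:S^\Psi\to S^\Phi$ is the natural projection (restriction), and for a site $z\in\Psi$, $\pi_z(u)=u(z)$. A transition probability kernel on $(\Gamma,\mathcal B)$: $P(x,\cdot)$ is a probability measure on $\mathcal B$ for each $x\in\Gamma$, and $P(\cdot,A)$ is measurable for each $A\in\mathcal B$. Conditions: (A1) (synchronous) For all $x\in\Gamma$, any finite $\Phi\subset W$ and each $v\in S^\Phi$, $P(x,\{y\in\Gamma:\pi_\Phi(y)=v\})=\prod_{z\in\Phi}P(x,\{y\in\Gamma:\pi_z(y)=\pi_z(v)\})$. (A2) (local) For any $z\in W$ there exist a finite set $N(z)\subset W$ with $z\in N(z)$ and a local transition kernel $P_z:S^{N(z)}\times S\to[0,1]$ (i.e.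 $P_z(h,\cdot)$ is a probability distribution on $S$ for each $h\in S^{N(z)}$) such that $P(x,\{y\in\Gamma:\pi_z(y)=s\})=P_z(\pi_{N(z)}(x),s)$ for all $x\in\Gamma$, $s\in S$. (A3) $P_z(v,s)>0$ for all $z\in W$, $v\in S^{N(z)}$, $s\in S$. (A4) For any $z\in W$ the set $D(z)=\{z'\in W: z\in N(z')\}$ is finite. Spatial tail $\sigma$-algebra: for $\Psi\subset W$ let $\mathcal B_\Psi\subset\mathcal B$ be the $\sigma$-algebra generated by the projections $\pi_z:\Gamma\to S$, $z\in\Psi$. Then $\widehat{\mathcal B}=\bigcap_{\Phi\subset W,\ \Phi\text{ finite}}\mathcal B_{W\setminus\Phi}$. Donsker–Varadhan action functional: for $\nu\in M(\Gamma)$, $$I(\nu)=-\inf_{f}\int_\Gamma\log\left(\frac{\int_\Gamma f(y)P(x,dy)}{f(x)}\right)\nu(dx)\in[0,\infty],$$ where the infimum is over all positive continuous functions $f$ on $\Gamma$. *)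

(* Defs.v *)
From HB Require Import structures.
From mathcomp Require Export all_boot all_order all_algebra finmap.
From mathcomp Require Export all_classical all_reals all_analysis.
From mathcomp Require Export measurable_realfun.
Export Order.TTheory GRing.Theory Num.Theory.
Export numFieldNormedType.Exports.

Set Implicit Arguments.
Unset Strict Implicit.
Unset Printing Implicit Defensive.

Local Open Scope classical_set_scope.
Local Open Scope ring_scope.

(* A measurableType must be pointed, so nonemptiness of the finite alphabet is
   carried by its structure; the chosen point plays no other role. *)
#[short(type="pointedFinType")]
HB.structure Definition PointedFinite := {T of Finite T & Pointed T}.

Definition config (W : Type) (S : pointedFinType) : Type :=
  prod_topology (fun _ : W => discrete_topology S).

Section config_instances.
Variables (W : Type) (S : pointedFinType).

HB.instance Definition _ := Topological.on (config W S).

HB.instance Definition _ :=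
  isPointed.Build (config W S) (fun=> point : discrete_topology S).

(* The Borel sigma-algebra of the product topology. *)
HB.instance Definition _ := Measurable.copy (config W S)
  (g_sigma_algebraType (@open (config W S))).

End config_instances.

Section definitions.
Variables (R : realType) (W : countType) (S : pointedFinType).
Local Notation Gamma := (config W S).

Definition proj_site (z : W) (x : Gamma) : S := x z.

Definition proj_sites (Phi : {fset W}) (x : Gamma) : {ffun Phi -> S} :=
  [ffun z : Phi => x (val z)].

Definition sites_algebra (Psi : set W) : set (set Gamma) :=
  <<s \bigcup_(z in Psi)
        preimage_set_system [set: Gamma] (proj_site z) [set: set S] >>.

Definition tail_algebra : set (set Gamma) :=
  \bigcap_(Phi in [set Phi : set W | finite_set Phi]) sites_algebra (~` Phi).

(* Hence [g_sigma_algebraType tail_algebra] has exactly the tail events as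
   measurable sets (measurable_g_measurableTypeE). *)
Lemma tail_sigma_algebra : sigma_algebra [set: Gamma] tail_algebra.
Proof.
split.
- by move=> Phi _; exact: sigma_algebra0.
- by move=> A tA Phi fPhi; apply: sigma_algebraCD; exact: tA.
- by move=> F tF Phi fPhi; apply: sigma_algebra_bigcup => i; exact: tF.
Qed.

Section kernel_conditions.
Variables (P : R.-pker Gamma ~> Gamma).
Variables (N : W -> {fset W}) (p : forall z, {ffun N z -> S} -> S -> R).

Definition synchronous : Prop :=
  forall (x : Gamma) (Phi : {fset W}) (v : {ffun Phi -> S}),
    P x [set y | proj_sites Phi y = v] =
    (\prod_(z : Phi) P x [set y | proj_site (val z) y = v z])%E.

Definition is_distribution (q : S -> R) : Prop :=
  (forall s, 0 <= q s) /\ \sum_s q s = 1.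

Definition local_transitions : Prop :=
  forall z : W,
    [/\ z \in N z,
        forall h : {ffun N z -> S}, is_distribution (p h) &
        forall (x : Gamma) (s : S),
          P x [set y | proj_site z y = s] = (p (proj_sites (N z) x) s)%:E].

Definition positive_transitions : Prop :=
  forall (z : W) (v : {ffun N z -> S}) (s : S), 0 < p v s.

Definition finite_influence : Prop :=
  forall z : W, finite_set [set z' : W | z \in N z'].

(* Each integrand is bounded, f being bounded above and away from 0 on the
   compact space of configurations: the real-valued inner integral is the true
   one and the outer one is never of the form +oo - oo. *)
Definition donsker_varadhan (nu : probability Gamma R) : \bar R :=
  (- ereal_inf
     [set \int[nu]_x (ln ((\int[P x]_y f y) / f x)%R)%:E |
        f in [set f : Gamma -> R | continuous f /\ forall x, (0 < f x)%R]])%E.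

End kernel_conditions.
End definitions.

(* Main.v *)
(* By the product structure, P(x,.) obeys Kolmogorov's 0-1 law, so P(x,A) is 0
   or 1 for a tail event A.  Were f = exp(c 1_A) admissible in the variational
   formula, then log(Pf/f)(x) = c (P(x,A) - 1_A(x)), whence
   -I(nu) <= c (nuP(A) - nu(A)) for every real c, which forces nuP(A) = nu(A).
   Since f has to be continuous, A is replaced by a clopen set C whose symmetric
   difference with A has small (nu + nuP)-measure e; for each fixed c this
   costs an error of order exp|c| e. *)
From HB Require Import structures.
Require Import Defs.
From mathcomp Require Import ring lra.

Set Implicit Arguments.
Unset Strict Implicit.
Unset Printing Implicit Defensive.

Local Open Scope classical_set_scope.
Local Open Scope ring_scope.

Lemma measurable_setY d (T : measurableType d) (A B : set T) :
  measurable A -> measurable B -> measurable (A `+` B).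
Proof.
by move=> mA mB; rewrite /setY; apply: measurableU; exact: measurableD.
Qed.

Section approximation.
Context d (T : measurableType d) (R : realType).
Variable mu : {measure set T -> \bar R}.
Hypothesis mu_fin : (mu setT < +oo)%E.
Variable G : set (set T).
Hypotheses (GT : G setT) (GC : setC_closed G) (GU : setU_closed G).
Hypothesis Gm : forall C, G C -> measurable C.

Lemma measure_symdiff_approx (A : set T) : <<s G >> A ->
  forall e : R, 0 < e -> exists2 C, G C & (mu (A `+` C) < e%:E)%E.
Proof.
pose Q A := measurable A /\
  forall e : R, 0 < e -> exists2 C, G C & (mu (A `+` C) < e%:E)%E.
suff QA : <<s G >> `<=` Q by move=> /QA [].
have Q0 : Q set0.
  split=> // e e0; exists set0; first by rewrite -setCT; exact: GC.
  by rewrite setYK measure0 lte_fin.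
have QU B C : Q B -> Q C -> Q (B `|` C).
  move=> [mB aB] [mC aC]; split=> [|e e0]; first exact: measurableU.
  have e20 : 0 < e / 2 by rewrite divr_gt0.
  have [B' GB' B'e] := aB _ e20; have [C' GC' C'e] := aC _ e20.
  exists (B' `|` C'); first exact: GU.
  have [mB' mC'] := (Gm GB', Gm GC').
  apply: (@le_lt_trans _ _ (mu ((B `+` B') `|` (C `+` C')))).
    apply: le_measure; rewrite ?inE; [by apply: measurable_setY; apply: measurableU| |].
      by apply: measurableU; exact: measurable_setY.
    by move=> x; rewrite /setY /setD /=; tauto.
  apply: le_lt_trans; first by apply: measureU2; exact: measurable_setY.
  by rewrite (splitr e) EFinD lteD.
apply: smallest_sub; last first.
  move=> C GC'; split=> [|e e0]; first exact: Gm.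
  by exists C => //; rewrite setYK measure0 lte_fin.
split=> // [B [mB aB]|F QF].
  rewrite setTD; split=> [|e e0]; first exact: measurableC.
  have [C GC' Ce] := aB _ e0; exists (~` C); first exact: GC.
  rewrite (_ : _ `+` _ = B `+` C)//.
  by apply/seteqP; split=> x; rewrite /setY /setD /setC /=;
    have := EM (B x); have := EM (C x); tauto.
have mF i : measurable (F i) by case: (QF i).
have mUF : measurable (\bigcup_i F i) by exact: bigcupT_measurable.
split=> // e e0.
pose U n := \big[setU/set0]_(i < n) F i.
have QUn n : Q (U n) by apply: big_ind => //; exact: QU.
have cU : (mu \o (fun n => (\bigcup_i F i) `\` U n)) n @[n --> \oo] --> 0%E.
  have := @nonincreasing_cvg_mu _ _ _ mu (fun n => (\bigcup_i F i) `\` U n).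
  have -> : \bigcap_n (\bigcup_i F i `\` U n) = set0.
    apply/seteqP; split=> // x /= hx; have [[i _ Fix] _] := hx 0%N I.
    by have [_] := hx i.+1 I; apply; rewrite /U big_ord_recr /=; right.
  rewrite measure0; apply=> //.
  - apply: le_lt_trans mu_fin; apply: le_measure; rewrite ?inE//.
    by apply: measurableD => //; case: (QUn 0%N).
  - by move=> n; apply: measurableD => //; case: (QUn n).
  - move=> m n mn; apply/subsetPset; apply: setDS.
    exact: subset_bigsetU.
have e20 : 0 < e / 2 by rewrite divr_gt0.
have [n Un] : exists n, (mu ((\bigcup_i F i) `\` U n) < (e / 2)%:E)%E.
  have : \forall n \near \oo, (mu ((\bigcup_i F i) `\` U n) < (e / 2)%:E)%E.
    exact: (cU _ (@nbhs_open_ereal_lt _ 0 (fun=> e / 2) e20)).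
  by case=> n _ /(_ n (leqnn n)) ?; exists n.
have [mUn /(_ _ e20)[C GC' Ce]] := QUn n; have mC := Gm GC'.
exists C => //.
apply: (@le_lt_trans _ _ (mu (((\bigcup_i F i) `\` U n) `|` (U n `+` C)))).
  apply: le_measure; rewrite ?inE; [exact: measurable_setY| |].
    by apply: measurableU; [exact: measurableD|exact: measurable_setY].
  have UF : U n `<=` \bigcup_i F i.
    by by rewrite /U -bigcup_mkord => x [i _ ?]; exists i.
  by move=> x; have := UF x; have := EM (U n x); rewrite /setY /setD /=; tauto.
apply: le_lt_trans.
  by apply: measureU2; [exact: measurableD|exact: measurable_setY].
by rewrite (splitr e) EFinD lteD.
Qed.

End approximation.

Lemma ln_1Dexp_le (R : realType) (c b u d : R) : 0 <= u -> u <= 1 ->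
  b = 0 \/ b = 1 -> `|u - b| <= d ->
  ln (1 + (expR c - 1) * u) <= c * b + expR `|c| * d.
Proof.
move=> u0 u1 b01 ubd.
have ec : expR c <= expR `|c| by rewrite ler_expR ler_norm.
have eNc : expR (- c) <= expR `|c| by rewrite ler_expR -normrN ler_norm.
have [[p1 p2] p3] := (expR_gt0 c, expR_gt0 (- c), expR_gt0 `|c|).
case: b01 ubd => ->.
  rewrite mulr0 add0r subr0 ger0_norm// => ud.
  have h : -1 < (expR c - 1) * u by nra.
  by apply: (le_trans (le_ln1Dx h)); nra.
rewrite mulr1 distrC ger0_norm ?subr_ge0// => ud.
have -> : 1 + (expR c - 1) * u = expR c * (1 + (expR (- c) - 1) * (1 - u)).
  by rewrite expRN; field; rewrite gt_eqF.
have h : -1 < (expR (- c) - 1) * (1 - u) by nra.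
rewrite lnM ?posrE// ?expRK; last by lra.
rewrite lerD2l; apply: (le_trans (le_ln1Dx h)).
nra.
Qed.

Section cylinders.
Variables (W : countType) (S : pointedFinType).
Local Notation Gamma := (config W S).
Implicit Types (F : {fset W}) (u : Gamma) (Psi : set W) (A : set Gamma).

Definition cylinder F u : set Gamma := [set y | forall z, z \in F -> y z = u z].

Definition cylinders Psi : set (set Gamma) :=
  [set A | A = set0 \/ exists F u, [set` F] `<=` Psi /\ A = cylinder F u].

Lemma proj_sites_cylinder F u :
  [set y | proj_sites F y = proj_sites F u] = cylinder F u.
Proof.
apply/seteqP; split=> y /= h.
  move=> z zF; have /ffunP/(_ [`zF]%fset) := h.
  by rewrite !ffunE.
by apply/ffunP => -[z zF]; rewrite !ffunE; exact: h.
Qed.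

Lemma cylinderI F F' u u' y : cylinder F u y -> cylinder F' u' y ->
  cylinder F u `&` cylinder F' u' = cylinder (F `|` F')%fset y.
Proof.
move=> uy u'y; apply/seteqP; split=> x /=.
  by move=> [ux u'x] z; rewrite inE => /orP[] zF;
    [rewrite ux// uy|rewrite u'x// u'y].
move=> yx; split=> z zF.
  by rewrite -uy//; apply: yx; rewrite inE zF.
by rewrite -u'y//; apply: yx; rewrite inE zF orbT.
Qed.

Lemma cylinder0 u : cylinder fset0 u = setT.
Proof. by apply/seteqP; split=> x // _ z; rewrite inE. Qed.

Lemma setI_closed_cylinders Psi : setI_closed (cylinders Psi).
Proof.
move=> A B [->|[F [u [FP ->]]]]; first by left; rewrite set0I.
move=> [->|[F' [u' [FP' ->]]]]; first by left; rewrite setI0.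
have [->|/set0P[y [uy u'y]]] := eqVneq (cylinder F u `&` cylinder F' u') set0.
  by left.
right; exists (F `|` F')%fset, y; split; last exact: cylinderI.
by move=> z /=; rewrite inE => /orP[/FP|/FP'].
Qed.

Lemma cylinder_sites_algebra Psi F u :
  [set` F] `<=` Psi -> sites_algebra Psi (cylinder F u).
Proof.
move=> FP.
have -> : cylinder F u = \bigcap_(z in [set` F]) (@proj_site W S z @^-1` [set u z]).
  by apply/seteqP; split.
set G := \bigcup_(z in Psi)
  preimage_set_system [set: Gamma] (@proj_site W S z) [set: set S].
apply: (@fin_bigcap_measurable _ (g_sigma_algebraType G)) => // z zF.
apply: sub_sigma_algebra; exists z; first exact: FP.
by exists [set u z] => //; rewrite setTI.
Qed.

Lemma sites_algebraE Psi : @sites_algebra W S Psi = <<s cylinders Psi >>.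
Proof.
apply/seteqP; split; last first.
  apply: smallest_sub; first exact: smallest_sigma_algebra.
  move=> A [->|[F [u [FP ->]]]]; first exact: sigma_algebra0.
  exact: cylinder_sites_algebra.
apply: smallest_sub; first exact: smallest_sigma_algebra.
move=> _ [z Pz [B _ <-]].
have -> : setT `&` @proj_site W S z @^-1` B =
    \bigcup_(s in B) cylinder [fset z]%fset (fun=> s).
  rewrite setTI; apply/seteqP; split=> x /=.
    by move=> Bx; exists (x z) => // z'; rewrite inE => /eqP ->.
  by move=> [s Bs /(_ z)]; rewrite inE eqxx => /(_ isT) xz; rewrite /proj_site xz.
apply: (@fin_bigcup_measurable _ (g_sigma_algebraType (cylinders Psi))) => //.
move=> s _; apply: sub_sigma_algebra; right; exists [fset z]%fset, (fun=> s).
by split=> // z' /=; rewrite inE => /eqP ->.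
Qed.

Lemma clopen_proj_site z (B : set S) : clopen (@proj_site W S z @^-1` B).
Proof.
apply: (@preimage_clopen Gamma (discrete_topology S)).
  by split; [exact: discrete_open|exact: discrete_closed].
exact: (@proj_continuous W (fun=> discrete_topology S) z).
Qed.

Lemma sites_algebra_clopen Psi : @sites_algebra W S Psi `<=` <<s @clopen Gamma >>.
Proof.
apply: sub_sigma_algebra2 => _ [z _ [B _ <-]].
by rewrite setTI; exact: clopen_proj_site.
Qed.

Lemma clopen_measurable A : clopen A -> measurable A.
Proof. by move=> [oA _]; exact: sub_sigma_algebra. Qed.

Lemma sites_algebra_measurable Psi A : sites_algebra Psi A -> measurable A.
Proof.
move=> /sites_algebra_clopen.
by apply: smallest_sub; [exact: sigma_algebra_measurable|exact: clopen_measurable].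
Qed.

Lemma tail_sites_algebra F A : tail_algebra A -> sites_algebra (~` [set` F]) A.
Proof. by move=> /(_ [set` F] (finite_fset F)). Qed.

Lemma tail_sites_algebraT A : tail_algebra A -> sites_algebra setT A.
Proof. by move=> /(_ set0 (finite_set0 _)); rewrite setC0. Qed.

End cylinders.

Lemma sites_algebra_indep (R : realType) (W : countType) (S : pointedFinType)
    (mu : {measure set (config W S) -> \bar R}) (Psi : set W)
    (D : set (config W S)) : (mu setT < +oo)%E -> measurable D ->
  (forall (F : {fset W}) u, [set` F] `<=` Psi ->
    mu (cylinder F u `&` D) = (mu (cylinder F u) * mu D)%E) ->
  forall A, sites_algebra Psi A -> mu (A `&` D) = (mu A * mu D)%E.
Proof.
move=> muT mD indep A; rewrite sites_algebraE => sA.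
have r0 : 0 <= fine (mu D) by exact: fine_ge0.
have muD : mu D = (fine (mu D))%:E by rewrite fineK//; exact: (lty_fin_num_fun muT).
have mE B : mscale (NngNum r0) mu B = (mu B * mu D)%E by rewrite [RHS]muleC [in RHS]muD.
rewrite -mE; apply: (@g_sigma_algebra_measure_unique _ R _ (cylinders Psi) _ (fun=> setT) _ _
  (mrestr mu mD) (mscale (NngNum r0) mu) _ _ _ A sA).
- by move=> B BG; apply: (@sites_algebra_measurable _ _ Psi); rewrite sites_algebraE;
    exact: sub_sigma_algebra.
- by move=> _; right; exists fset0, point; split=> [?|]; rewrite ?inE// cylinder0.
- by rewrite bigcup_const//; exists 0%N.
- exact: setI_closed_cylinders.
- move=> B [->|[F [u [FP ->]]]]; first by rewrite !measure0.
  by rewrite [LHS]indep//; exact/esym/mE.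
- by move=> _; rewrite -[ltLHS]/(mu (setT `&` D)) setTI ltey_eq (lty_fin_num_fun muT).
Qed.

Section kernel.
Variables (R : realType) (W : countType) (S : pointedFinType).
Local Notation Gamma := (config W S).
Variables (P : R.-pker Gamma ~> Gamma) (N : W -> {fset W})
  (p : forall z : W, {ffun N z -> S} -> S -> R).
Hypotheses (A1 : synchronous P) (A2 : local_transitions P p).

Lemma kernel_cylinder x F u :
  P x (cylinder F u) = (\prod_(z <- F) p (proj_sites (N z) x) (u z))%:E.
Proof.
rewrite -proj_sites_cylinder A1 -prodEFin big_seq_fsetE.
apply: eq_bigr => z _; rewrite ffunE.
by have [_ _ ->] := A2 (val z).
Qed.

Lemma kernel_cylinder_indep x F F' u u' : [set` F'] `<=` ~` [set` F] ->
  P x (cylinder F' u' `&` cylinder F u) =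
  (P x (cylinder F' u') * P x (cylinder F u))%E.
Proof.
move=> FF'; pose w : Gamma := fun z => if z \in F then u z else u' z.
have uw : cylinder F u w by move=> z zF; rewrite /w zF.
have u'w : cylinder F' u' w.
  by move=> z /FF' /negP/negbTE zF; rewrite /w zF.
rewrite (cylinderI u'w uw) !kernel_cylinder -EFinM; congr EFin.
have pF : perm_eq (F' `|` F)%fset (F' ++ F).
  apply: uniq_perm => [||z]; first exact: fset_uniq.
    rewrite cat_uniq !fset_uniq andbT /=; apply/hasPn => z zF.
    by apply/negP => /FF'.
  by rewrite mem_cat inE.
rewrite (perm_big _ pF) big_cat /=; congr (_ * _); apply: eq_big_seq => z.
  by move=> /u'w ->.
by move=> /uw ->.
Qed.

Lemma tail_kernel01 x A : tail_algebra A -> P x A = 0%E \/ P x A = 1%E.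
Proof.
move=> tA; have mA := sites_algebra_measurable (tail_sites_algebraT tA).
have PT : (P x setT < +oo)%E by rewrite prob_kernel ltry.
have PA : P x A = (P x A * P x A)%E.
  rewrite -[in LHS](setIid A).
  apply: (sites_algebra_indep PT mA) (tail_sites_algebraT tA) => F u _.
  have mF : measurable (cylinder F u).
    exact: sites_algebra_measurable (cylinder_sites_algebra _ (@subsetT _ _)).
  rewrite setIC muleC.
  refine (sites_algebra_indep PT mF _ (tail_sites_algebra tA)) => F' u'.
  exact: kernel_cylinder_indep.
have := lty_fin_num_fun PT mA; rewrite fin_numE; move: PA.
case: (P x A) => [r||] //= [rr] _.
have /eqP : r * (r - 1) = 0 by rewrite mulrBr -rr mulr1 subrr.
by rewrite mulf_eq0 subr_eq0 => /orP[]/eqP ->; [left|right].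
Qed.

Lemma measurable_proj_sites Psi (F : {fset W}) (g : {ffun F -> S} -> R) :
  [set` F] `<=` Psi ->
  measurable_fun [set: g_sigma_algebraType (@cylinders W S Psi)]
    (fun x => g (proj_sites F x)).
Proof.
move=> FP _ B _; rewrite setTI.
have -> : (fun x : Gamma => g (proj_sites F x)) @^-1` B =
    \bigcup_(h in [set h | B (g h)]) [set x | proj_sites F x = h].
  by apply/seteqP; split=> x /= => [Bx|[h Bh ->]]//; exists (proj_sites F x).
apply: fin_bigcup_measurable => // h _.
have [->|/set0P[u /= <-]] := eqVneq [set x | proj_sites F x = h] set0.
  exact: measurable0.
rewrite proj_sites_cylinder; apply: sub_sigma_algebra.
by right; exists F, u.
Qed.

Lemma measurable_kernel_sites (Psi Psi' : set W) A :
  (forall z, Psi z -> [set` N z] `<=` Psi') -> sites_algebra Psi A ->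
  measurable_fun [set: g_sigma_algebraType (@cylinders W S Psi')]
    (fun x => P x A).
Proof.
move=> NP; rewrite sites_algebraE => sA.
pose Q B := measurable_fun [set: g_sigma_algebraType (@cylinders W S Psi')]
  (fun x => P x B).
have mB (B : set Gamma) : <<s cylinders Psi >> B -> measurable B.
  by rewrite -sites_algebraE; exact: sites_algebra_measurable.
have PC x (B : set Gamma) : measurable B -> P x (~` B) = (1 - P x B)%E.
  move=> mB'; have PT : (P x setT < +oo)%E by rewrite prob_kernel ltry.
  rewrite -(@prob_kernel _ _ _ _ _ P x) -setTD -[in RHS](setTI B).
  exact: measureD.
apply: (@dynkin_induction _ (g_sigma_algebraType (@cylinders W S Psi))
  (cylinders Psi) Q) sA => //.
- exact: setI_closed_cylinders.
- rewrite /Q; under eq_fun do rewrite prob_kernel; exact: measurable_cst.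
- move=> B [->|[F [u [FP ->]]]].
    by rewrite /Q; under eq_fun do rewrite measure0; exact: measurable_cst.
  rewrite /Q; under eq_fun do rewrite kernel_cylinder.
  apply/measurable_EFinP.
  apply: measurable_prod => z zF.
  by apply: (@measurable_proj_sites _ (N z) (fun h => p h (u z))); exact/NP/FP.
- move=> B sB QB; rewrite /Q.
  have -> : (fun x => P x (~` B)) = (fun x => 1 - P x B)%E.
    by apply/funext => x; apply: PC; exact: mB.
  exact: emeasurable_funB.
- move=> F sF tF QF; rewrite /Q.
  have -> : (fun x => P x (\bigcup_k F k)) = (fun x => \sum_(n <oo) P x (F n))%E.
    apply/funext => x; apply: measure_semi_bigcup => //.
    by move=> n; apply: mB; exact: sF.
    by apply: bigcupT_measurable => n; apply: mB; exact: sF.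
  apply: ge0_emeasurable_sum => [k x _ _|k _]; last exact: QF.
  exact: (measure_ge0 (P x)).
Qed.

Lemma tail_kernel_measurable A : finite_influence N -> tail_algebra A ->
  measurable_fun [set: g_sigma_algebraType (@tail_algebra W S)]
    (fun x : Gamma => P x A).
Proof.
move=> A4 tA _ B mB; apply: sub_sigma_algebra => F finF.
pose D := \bigcup_(z in F) [set z' | z \in N z'].
have sA : sites_algebra (~` D) A.
  by apply: tA; apply: bigcup_finite => // z _; exact: A4.
rewrite sites_algebraE; apply: (measurable_kernel_sites _ sA) => //.
by move=> z zD z' /= z'N Fz'; apply: zD; exists z'.
Qed.

End kernel.

Section kernel_mean.
Context d d' (X : measurableType d) (Y : measurableType d') (R : realType).
Variables (nu : {measure set X -> \bar R}) (k : R.-ker X ~> Y).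

Definition kernel_mean (A : set Y) : \bar R := (\int[nu]_x k x A)%E.

Let kernel_mean0 : kernel_mean set0 = 0%E.
Proof. by apply: integral0_eq => x _; rewrite measure0. Qed.

Let kernel_mean_ge0 A : (0 <= kernel_mean A)%E.
Proof. exact: integral_ge0. Qed.

Let kernel_mean_sigma_additive : semi_sigma_additive kernel_mean.
Proof.
move=> U mU tU mUU; rewrite [X in _ --> X](_ : _ =
  (\int[nu]_x (\sum_(n <oo) k x (U n)))%E); last first.
  by apply: eq_integral => x _; exact: measure_semi_bigcup.
apply/cvg_closeP; split.
  by apply: is_cvg_nneseries => n _ _; exact: integral_ge0.
rewrite closeE// integral_nneseries// => n.
exact: measurable_kernel.
Qed.

HB.instance Definition _ := isMeasure.Build _ _ R kernel_mean
  kernel_mean0 kernel_mean_ge0 kernel_mean_sigma_additive.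

End kernel_mean.

Section finite_total_mass.
Context d (T : measurableType d) (R : realType).
Variable mu : {measure set T -> \bar R}.
Hypothesis mu_fin : (mu setT < +oo)%E.

Lemma integrable_norm_le (f : T -> R) (M : R) :
  measurable_fun setT f -> (forall x, `|f x| <= M) ->
  mu.-integrable setT (EFin \o f).
Proof.
move=> mf fM; apply: measurable_bounded_integrable => //.
by exists M; split; [exact: num_real|move=> K MK x _; exact: le_trans (fM x) (ltW MK)].
Qed.

Lemma Rintegral_indic (C : set T) : measurable C ->
  \int[mu]_x \1_C x = fine (mu C).
Proof. by move=> mC; rewrite /Rintegral integral_indic// setIT. Qed.

Lemma EFin_Rintegral (f : T -> R) : mu.-integrable setT (EFin \o f) ->
  (\int[mu]_x (f x)%:E)%E = (\int[mu]_x f x)%:E.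
Proof. by move=> fi; rewrite fineK//; exact: integrable_fin_num. Qed.

Lemma measure_symdiff_dist (A C : set T) : measurable A -> measurable C ->
  `|fine (mu C) - fine (mu A)| <= fine (mu (A `+` C)).
Proof.
have fin (B : set T) : measurable B -> mu B \is a fin_num.
  exact: (lty_fin_num_fun mu_fin).
suff le (B D : set T) : measurable B -> measurable D ->
    fine (mu B) <= fine (mu D) + fine (mu (B `+` D)).
  move=> mA mC; have := le _ _ mA mC; have := le _ _ mC mA.
  by rewrite ler_norml [C `+` A]setYC; lra.
move=> mB mD; have mBD := measurable_setY mB mD.
rewrite -fineD ?fin//; apply: fine_le; rewrite ?fin_numD ?fin//.
apply: (@le_trans _ _ (mu (D `|` (B `+` D)))); last exact: measureU2.
apply: le_measure; rewrite ?inE//; first exact: measurableU.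
by move=> x; have := EM (D x); rewrite /setY /setD /=; tauto.
Qed.

End finite_total_mass.

Lemma continuous_clopen_indic (T : topologicalType) (R : realType) (C : set T)
  (g : R -> R) : clopen C -> continuous (fun x => g (\1_C x)).
Proof.
move=> [oC cC] x; apply: (near_cst_continuous (g (\1_C x))).
have [Cx|nCx] := pselect (C x).
  have : \forall y \near x, C y by exact: open_nbhs_nbhs.
  by apply: filterS => y Cy; rewrite !indicE !mem_set.
have : \forall y \near x, (~` C) y.
  by apply: open_nbhs_nbhs; split => //; exact: closed_openC.
by apply: filterS => y Cy; rewrite !indicE !memNset.
Qed.

Section variational_formula.
Variables (R : realType) (W : countType) (S : pointedFinType).
Local Notation Gamma := (config W S).
Variables (P : R.-pker Gamma ~> Gamma) (nu : probability Gamma R).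

Lemma donsker_varadhan_lower : (donsker_varadhan P nu < +oo)%E ->
  exists K : R, forall f : Gamma -> R, continuous f -> (forall x, 0 < f x) ->
    (K%:E <= \int[nu]_x (ln ((\int[P x]_y f y)%R / f x))%:E)%E.
Proof.
rewrite /donsker_varadhan; set E := [set _ | _ in _].
have lbE (f : Gamma -> R) : continuous f -> (forall x, 0 < f x) ->
    (ereal_inf E <= \int[nu]_x (ln ((\int[P x]_y f y)%R / f x))%:E)%E.
  by move=> cf f0; apply: ereal_inf_lbound; exists f.
case: (ereal_inf E) lbE => [r||] lbE; last by rewrite /= ltxx.
- by move=> _; exists r.
- move=> _; exists 0 => f cf f0; apply: le_trans (lbE f cf f0).
  exact: leey.
Qed.

Lemma Rintegral_kernel_expR x (c : R) (C : set Gamma) : measurable C ->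
  \int[P x]_y expR (c * \1_C y) = 1 + (expR c - 1) * fine (P x C).
Proof.
move=> mC.
have PT : (P x setT < +oo)%E by rewrite prob_kernel ltry.
have -> : (fun y => expR (c * \1_C y)) = (fun y => 1 + (expR c - 1) * \1_C y).
  apply/funext => y; rewrite indicE; case: (y \in C).
    by rewrite !mulr1 addrC subrK.
  by rewrite !mulr0 expR0 addr0.
have iC : (P x).-integrable setT (EFin \o (\1_C : Gamma -> R)).
  apply: (@integrable_norm_le _ _ _ _ PT _ 1) => //.
  by move=> y; rewrite indicE; case: (y \in C); rewrite ?normr1 ?normr0.
rewrite RintegralD//.
- rewrite Rintegral_cst// RintegralZl// Rintegral_indic//.
  by rewrite [P x setT]prob_kernel mulr1.
- by apply: (@integrable_norm_le _ _ _ _ PT _ 1) => // y; rewrite normr1.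
  exact: (integrableZl measurableT _ iC).
Qed.

Lemma kernel_fine01 x A : measurable A -> 0 <= fine (P x A) <= 1.
Proof.
move=> mA; have PT : (P x setT < +oo)%E by rewrite prob_kernel ltry.
rewrite fine_ge0//= -lee_fin fineK; last exact: (lty_fin_num_fun PT).
by rewrite -(@prob_kernel _ _ _ _ _ P x) le_measure// inE.
Qed.

Lemma measurable_fine_kernel A : measurable A ->
  measurable_fun [set: Gamma] (fun x => fine (P x A)).
Proof.
move=> mA; apply: measurableT_comp; last exact: measurable_kernel.
exact: fine_measurable.
Qed.

Let nuT : (nu setT < +oo)%E.
Proof. by rewrite probability_setT ltry. Qed.

Lemma integrable_fine_kernel A : measurable A ->
  nu.-integrable setT (EFin \o (fun x => fine (P x A))).
Proof.
move=> mA; apply: (@integrable_norm_le _ _ _ _ nuT _ 1).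
  exact: measurable_fine_kernel.
by move=> x; have /andP[? ?] := kernel_fine01 x mA; rewrite ger0_norm.
Qed.

Lemma kernel_meanE A : measurable A ->
  kernel_mean nu P A = (\int[nu]_x fine (P x A))%:E.
Proof.
move=> mA; rewrite -(EFin_Rintegral (integrable_fine_kernel mA)).
apply: eq_integral => x _; rewrite fineK//.
have PT : (P x setT < +oo)%E by rewrite prob_kernel ltry.
exact: (lty_fin_num_fun PT).
Qed.

Lemma donsker_varadhan_clopen (K c : R) (A C : set Gamma) :
  (forall f : Gamma -> R, continuous f -> (forall x, 0 < f x) ->
    (K%:E <= \int[nu]_x (ln ((\int[P x]_y f y)%R / f x))%:E)%E) ->
  measurable A -> (forall x, P x A = 0%E \/ P x A = 1%E) -> clopen C ->
  K <= c * fine (kernel_mean nu P A)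
       + expR `|c| * fine (kernel_mean nu P (A `+` C)) - c * fine (nu C).
Proof.
move=> lbK mA A01 clC; have mC := clopen_measurable clC.
have mAC : measurable (A `+` C) by exact: measurable_setY.
have := lbK _ (@continuous_clopen_indic Gamma R C (fun t => expR (c * t)) clC)
  (fun x => expR_gt0 _).
have ln_bound x : `|ln (1 + (expR c - 1) * fine (P x C))| <= `|c|.
  have /andP[u0 u1] := kernel_fine01 x mC.
  have [cp cm] : expR c <= expR `|c| /\ expR (- `|c|) <= expR c.
    by rewrite !ler_expR ler_norm lerNl -normrN ler_norm.
  have [e1 e2] : 1 <= expR `|c| /\ expR (- `|c|) <= 1.
    by rewrite -{1}expR0 ler_expR expR_le1 oppr_le0 normr_ge0.
  have e0 := expR_gt0 (- `|c|).
  have pos : 0 < 1 + (expR c - 1) * fine (P x C) by nra.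
  rewrite ler_norml; apply/andP; split.
    by rewrite -[leLHS]expRK ler_ln ?posrE ?expR_gt0//; nra.
  by rewrite -[leRHS]expRK ler_ln ?posrE ?expR_gt0//; nra.
pose f x := ln (1 + (expR c - 1) * fine (P x C)) - c * \1_C x : R.
have fE x : ln ((\int[P x]_y expR (c * \1_C y)) / expR (c * \1_C x)) = f x.
  rewrite Rintegral_kernel_expR// ln_div ?posrE ?expR_gt0 ?expRK//.
  rewrite -Rintegral_kernel_expR//.
  have /andP[u0 u1] := kernel_fine01 x mC; have := expR_gt0 c.
  by rewrite Rintegral_kernel_expR//; nra.
under eq_integral do rewrite fE.
have i1 : nu.-integrable setT (EFin \o (\1_C : Gamma -> R)).
  exact: integrable_indic.
have ia := integrable_fine_kernel mA.
have id := integrable_fine_kernel mAC.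
have iac := integrableZl measurableT c ia.
have idc := integrableZl measurableT (expR `|c|) id.
have i1c := integrableZl measurableT (- c) i1.
pose g x := c * fine (P x A) + expR `|c| * fine (P x (A `+` C)) + - c * \1_C x : R.
have igac := integrableD measurableT iac idc.
have ig : nu.-integrable setT (EFin \o g) := integrableD measurableT igac i1c.
have mf : measurable_fun setT f.
  apply: measurable_funB; last exact: measurable_funM.
  apply: measurableT_comp; first exact: measurable_ln.
  apply: measurable_funD => //; apply: measurable_funM => //.
  exact: measurable_fine_kernel.
have if_ : nu.-integrable setT (EFin \o f).
  apply: (@integrable_norm_le _ _ _ _ nuT _ (`|c| + `|c|)) => // x.
  apply: (le_trans (ler_normB _ _)); rewrite lerD// normrM ler_piMr//.
  by rewrite indicE; case: (x \in C); rewrite ?normr1 ?normr0.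
have fg : (\int[nu]_x (f x)%:E <= \int[nu]_x (g x)%:E)%E.
  apply: le_integral => // x _; rewrite lee_fin /f /g mulNr lerD2r.
  have /andP[u0 u1] := kernel_fine01 x mC.
  have PT : (P x setT < +oo)%E by rewrite prob_kernel ltry.
  apply: ln_1Dexp_le => //; first by case: (A01 x) => ->; [left|right].
  exact: measure_symdiff_dist.
move=> /le_trans /(_ fg); rewrite (EFin_Rintegral ig) lee_fin /g.
rewrite RintegralD// RintegralD// !RintegralZl// Rintegral_indic//.
by rewrite !kernel_meanE// mulNr.
Qed.

Lemma donsker_varadhan_tail A : (donsker_varadhan P nu < +oo)%E ->
  sites_algebra setT A -> (forall x, P x A = 0%E \/ P x A = 1%E) ->
  (\int[nu]_x P x A = nu A)%E.
Proof.
move=> /donsker_varadhan_lower [K lbK] sA A01.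
have mA := sites_algebra_measurable sA.
have mT : (kernel_mean nu P setT < +oo)%E by rewrite kernel_meanE// ltry.
have nuA : nu A \is a fin_num := lty_fin_num_fun nuT mA.
pose a := fine (kernel_mean nu P A); pose b := fine (nu A).
suff ab : a = b.
  by rewrite -[LHS]/(kernel_mean nu P A) kernel_meanE// -(fineK nuA) -/b -ab /a kernel_meanE.
have Kc c : K <= c * (a - b).
  apply/ler_addgt0Pl => e e0.
  pose L := expR `|c| + `|c|.
  have L0 : 0 < L by rewrite ltr_pwDl// expR_gt0.
  pose m := measure_add nu (kernel_mean nu P).
  have mfin : (m setT < +oo)%E by rewrite /m measure_addE lte_add_pinfty.
  have [||||C clC] := measure_symdiff_approx mfin _ _ _ _
    (sites_algebra_clopen sA) (divr_gt0 e0 L0).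
  - exact: clopenT.
  - by move=> ? ?; exact: clopenC.
  - exact: clopenU.
  - exact: clopen_measurable.
  rewrite [X in (X < _)%E](measure_addE nu (kernel_mean nu P)).
  rewrite -[X in (X < _)%E]/(nu (A `+` C) + kernel_mean nu P (A `+` C))%E => small.
  have mC := clopen_measurable clC.
  have mAC : measurable (A `+` C) by exact: measurable_setY.
  have := donsker_varadhan_clopen c lbK mA A01 clC.
  have := measure_symdiff_dist nuT mA mC.
  have nuAC : nu (A `+` C) \is a fin_num := lty_fin_num_fun nuT mAC.
  have PAC : kernel_mean nu P (A `+` C) \is a fin_num := lty_fin_num_fun mT mAC.
  move: small; rewrite -(fineK nuAC) -(fineK PAC) -EFinD lte_fin ltr_pdivlMr// /=.
  rewrite -/a -/b.
  have : 0 <= fine (nu (A `+` C)) by rewrite fine_ge0.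
  have : 0 <= fine (kernel_mean nu P (A `+` C)) by rewrite fine_ge0.
  set s := fine (nu (A `+` C)); set t := fine (kernel_mean nu P (A `+` C)).
  move=> t0 s0 st dist bound.
  have : - c * (fine (nu C) - b) <= `|c| * s.
    by rewrite (le_trans (ler_norm _))// normrM normrN ler_wpM2l.
  have := expR_gt0 `|c|; have := normr_ge0 c.
  move: bound st; rewrite /L; nra.
apply: contrapT => /eqP; rewrite -subr_eq0 => ab0.
have := Kc ((K - 1) / (a - b)); rewrite divfK//; lra.
Qed.

End variational_formula.

Theorem theorem1 (R : realType) (W : countType) (S : pointedFinType)
    (hW : infinite_set [set: W])
    (P : R.-pker config W S ~> config W S)
    (N : W -> {fset W}) (p : forall z : W, {ffun N z -> S} -> S -> R)
    (A1 : synchronous P)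
    (A2 : local_transitions P p)
    (A3 : positive_transitions p)
    (A4 : finite_influence N) :
  (forall A : set (config W S), @tail_algebra W S A ->
     measurable_fun [set: g_sigma_algebraType (@tail_algebra W S)]
       (fun x : config W S => P x A)) /\
  (forall nu : probability (config W S) R, (donsker_varadhan P nu < +oo)%E ->
     forall A : set (config W S), @tail_algebra W S A ->
       (\int[nu]_x P x A = nu A)%E).
Proof.
split=> [A tA|nu Inu A tA]; first exact: (tail_kernel_measurable A1 A2 A4 tA).
apply: donsker_varadhan_tail Inu (tail_sites_algebraT tA) _ => x.
exact: (tail_kernel01 A1 A2).
Qed.
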